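(* Let $G$ be a Polish, locally compact group. If $G\in\mathsf{GPP}$, then $G$ is compact. In particular, if $G$ is non-compact, then $\mathrm{M}(G)$ contains no points of first countability.
   Context: A $G$-flow is a compact Hausdorff space with a continuous left $G$-action $G\times X\to X$; it is minimal if every orbit is dense. $\mathrm{M}(G)$ is the universal minimal flow of $G$: the (unique up to isomorphism) minimal $G$-flow which admits a continuous $G$-equivariant map onto every minimal $G$-flow. $\mathsf{GPP}$ is the class of Polish groups $G$ with the generic point property: every minimal $G$-flow has a comeager orbit (equivalently, $\mathrm{M}(G)$ has a comeager orbit). A point of first countability of a space is a point with a countable neighborhood base. *)

(* Defs.v *)
From HB Require Import structures.
From mathcomp Require Import all_boot all_algebra.
From mathcomp Require Import all_classical reals topology borel_hierarchy.

Set Implicit Arguments.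
Unset Strict Implicit.
Unset Printing Implicit Defensive.

Local Open Scope classical_set_scope.

HB.mixin Record isTopologicalGroup G & Topological G & Group G := {
  mulg_continuous : continuous (fun x : G * G => (x.1 * x.2)%g) ;
  invg_continuous : continuous (fun x : G => x^-1%g)
}.

#[short(type="topologicalGroupType")]
HB.structure Definition TopologicalGroup :=
  {G of Topological G & Group G & isTopologicalGroup G}.

Section topological_notions.
Context {T : topologicalType}.

Definition separable_space := exists2 D : set T, countable D & dense D.

(* T is homeomorphic to a metric space M in which every Cauchy filter
   converges; equivalently, T carries a compatible complete metric. *)
Definition completely_metrizable (R : realType) :=
  exists (M : metricType R) (f : T -> M) (g : M -> T),
    [/\ continuous f, continuous g, cancel f g, cancel g f &
        forall F : set_system M, ProperFilter F -> cauchy F ->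
          exists x : M, F --> x].

Definition comeager (A : set T) := exists2 S, Gdelta_dense S & S `<=` A.

Definition first_countable_at (x : T) :=
  exists2 B : set (set T), countable B &
    B `<=` nbhs x /\ forall U, nbhs x U -> exists2 V, B V & V `<=` U.

End topological_notions.
Arguments separable_space : clear implicits.
Arguments completely_metrizable : clear implicits.

Definition polish (R : realType) (T : topologicalType) :=
  separable_space T /\ completely_metrizable T R.

Record flow (G : topologicalGroupType) := Flow {
  flow_space :> topologicalType ;
  flow_act : G -> flow_space -> flow_space ;
  flow_compact : compact [set: flow_space] ;
  flow_hausdorff : hausdorff_space flow_space ;
  flow_act1 : forall x, flow_act 1%g x = x ;
  flow_actM : forall g h x, flow_act (g * h)%g x = flow_act g (flow_act h x) ;
  flow_act_continuous :
    continuous (fun p : G * flow_space => flow_act p.1 p.2)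
}.

Arguments flow_act {G f} g x : rename.

Section flows.
Context {G : topologicalGroupType}.

Definition flow_orbit (X : flow G) (x : X) : set X :=
  [set flow_act g x | g in [set: G]].

(* The empty flow, whose orbits are vacuously all dense, is excluded: it has
   no comeager orbit and is the target of no map from a nonempty flow. *)
Definition minimal_flow (X : flow G) :=
  [set: X] !=set0 /\ forall x : X, dense (flow_orbit x).

Definition equivariant (X Y : flow G) (f : X -> Y) :=
  forall g x, f (flow_act g x) = flow_act g (f x).

(* M is (a copy of) the universal minimal flow M(G). *)
Definition universal_minimal_flow (M : flow G) :=
  minimal_flow M /\
  forall X : flow G, minimal_flow X ->
    exists f : M -> X,
      [/\ continuous f, equivariant f & set_surj [set: M] [set: X] f].

End flows.

(* GPP: Polish groups with the generic point property. *)
Definition GPP (R : realType) (G : topologicalGroupType) :=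
  polish R G /\
  forall X : flow G, minimal_flow X -> exists x : X, comeager (flow_orbit x).

(* Main.v *)
Require Import Defs.
From mathcomp Require Import all_boot all_order all_algebra.
From mathcomp Require Import all_classical reals topology normedtype borel_hierarchy.
Import Order.TTheory GRing.Theory Num.Theory numFieldNormedType.Exports.

(** Write [G x] for the orbit of [x]. The two assertions are reduced to one dynamical
    property of a single minimal flow [X], namely a minimal subflow of the greatest
    ambit of [G]: for some compact [L], there are no point [x] of [X] and sequence
    [g n] of elements outside [L] with [g n x --> x]
    ([exists_minimal_flow_no_return]).

    When [G] is not compact, this excludes comeager orbits in [X] and points of
    first countability in the universal minimal flow. If [X] has a comeager orbit
    [G x], then by Baire's theorem and sigma-compactness of [G] some [K x], with [K]
    compact, has interior ([comeager_orbit_interior]). So the stabilizer of [x] is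
    cocompact, hence not contained in [L] ([stabilizer_not_in_compact]), and one of
    its elements, repeated, is a forbidden sequence. Let now [x] be a point of any
    minimal flow. Elements outside [L] bring [x] back to any of its neighborhoods
    ([minimal_flow_return]). If [x] is a point of first countability of the
    universal minimal flow, this yields a sequence outside [L] with [g n x --> x],
    and its image under an equivariant map onto [X] is a forbidden sequence again.

    The dynamical property is a quantitative form of the theorem of Veech that a
    locally compact group acts freely on its greatest ambit. A point of the ambit is
    represented by an ultrafilter on [G]. An element [h] outside of [L] moves every
    ultrafilter by a definite amount: a colouring of a graph of bounded degree
    cuts [G] into finitely many pieces, each of them moved by [h] uniformly away from
    itself ([ultra_displacement]). As in the proof that an extremally disconnected
    compact space has no nontrivial convergent sequence, this rules out convergence of
    [g n x] to [x] ([no_return_far]). *)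

Set Implicit Arguments.
Unset Strict Implicit.
Unset Printing Implicit Defensive.
Local Open Scope classical_set_scope.

(** * Compactness and topological groups *)

(** Finite subcovers in the form of an induction principle: the sets whose
    complement in [K] has [P] form a filter, which has a cluster point in [K] unless
    it contains the empty set. *)
Lemma compact_ind (T : topologicalType) (K : set T) (P : set T -> Prop) :
    P set0 -> (forall A B, P A -> P B -> P (A `|` B)) ->
    (forall A B, A `<=` B -> P B -> P A) ->
    (forall x, K x -> exists2 U, nbhs x U & P U) ->
  compact K -> P K.
Proof.
move=> P0 PU PS Ploc Kc; apply: contrapT => nPK.
pose F : set_system T := [set A | P (K `\` A)].
have FF : ProperFilter F.
  split; first by rewrite /F /= setD0.
  split.
  - by rewrite /F /= setDT.
  - by move=> A B FA FB; rewrite /F /= setDIr; apply: PU.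
  - by move=> A B sAB; apply: PS => x [Kx nBx]; split => // /sAB.
have FK : F K by rewrite /F /= setDv.
have [x [Kx clx]] := Kc F FF FK.
have [U Ux PUx] := Ploc x Kx.
have FU : F (~` U) by rewrite /F /= setDE setCK; apply: PS PUx; exact: subIsetr.
by have [y []] := clx _ _ FU Ux.
Qed.

Section topological_group.
Context {G : topologicalGroupType}.
Implicit Types (g h x y : G) (A B U : set G).

Lemma continuous_mulg (T : topologicalType) (f k : T -> G) :
  continuous f -> continuous k -> continuous (fun t => f t * k t)%g.
Proof.
move=> cf ck t.
apply: (@continuous_comp _ _ _ (fun t => (f t, k t)) (fun p => p.1 * p.2)%g).
  by apply: cvg_pair; [exact: cf|exact: ck].
exact: mulg_continuous.
Qed.

Lemma continuous_invg (T : topologicalType) (f : T -> G) :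
  continuous f -> continuous (fun t => (f t)^-1)%g.
Proof.
move=> cf t; apply: (@continuous_comp _ _ _ f); first exact: cf.
exact: invg_continuous.
Qed.

Lemma compact_mulg A B : compact A -> compact B ->
  compact [set x * y | x in A & y in B]%g.
Proof.
move=> cA cB; have := compact_setX cA cB.
move=> /(continuous_compact (continuous_subspaceT (@mulg_continuous G))).
congr compact; apply/seteqP; split => [_ [[x y] [/= Ax By] <-]|_ [x Ax [y By <-]]].
  by exists x => //; exists y.
by exists (x, y).
Qed.

Lemma nbhs1_div U : nbhs 1%g U ->
  exists2 V, nbhs 1%g V & forall x y, V x -> V y -> U (x * y^-1)%g.
Proof.
move=> U1.
have cdiv : continuous (fun p : G * G => p.1 * p.2^-1)%g.
  apply: continuous_mulg => [p|]; first exact: cvg_fst.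
  by apply: continuous_invg => p; exact: cvg_snd.
have [|[V W] [/= V1 W1] VWU] := cdiv (1, 1)%g U.
  by rewrite /= invg1 mulg1.
exists (V `&` W); first exact: filterI.
by move=> x y [Vx _] [_ Wy]; apply: (VWU (x, y)).
Qed.

Lemma nbhs1_mulr U x : nbhs 1%g U -> nbhs x [set y | U (y * x^-1)%g].
Proof.
move=> U1.
have c : continuous (fun y => y * x^-1)%g.
  by apply: continuous_mulg => y; [exact: cvg_id|exact: cvg_cst].
by apply: c; rewrite mulgV.
Qed.

Lemma nbhs1_conj U g : nbhs 1%g U -> nbhs 1%g [set x | U (g * x * g^-1)%g].
Proof.
move=> U1.
have c : continuous (fun x => g * x * g^-1)%g.
  apply: continuous_mulg => y; last exact: cvg_cst.
  by apply: continuous_mulg => {}y; [exact: cvg_cst|exact: cvg_id].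
by apply: c; rewrite mulg1 mulgV.
Qed.

Hypothesis lcG : locally_compact [set: G].

Lemma symmetric_compact_nbhs1 : exists U : set G,
  [/\ nbhs 1%g U, compact U & forall x, U x -> U x^-1%g].
Proof.
have [K nK [cK _]] := @lcG 1%g Logic.I.
have {}nK : nbhs (1%g : G) K.
  by move: nK; rewrite /within/=; apply: filterS => x; exact.
exists (K `|` [set x^-1%g | x in K]); split.
- by apply: filterS nK => x; left.
- apply: compactU => //; apply: continuous_compact => //.
  exact/continuous_subspaceT/invg_continuous.
- move=> x [Kx|[y Ky <-]]; first by right; exists x.
  by left; rewrite invgK.
Qed.

End topological_group.

(** * Uniformly continuous functions on a locally compact group *)

Section uniformly_continuous_functions.
Context {R : realType} {G : topologicalGroupType}.
Implicit Types (g h x y : G) (A B U : set G) (f : G -> R).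
Local Open Scope ring_scope.

(** The uniformity is the one for which left translates of [f] depend continuously,
    in the uniform norm, on the translating element. These functions therefore
    extend to a compactification of [G] on which [G] acts jointly continuously. *)
Definition ruc01 f := (forall x, 0 <= f x <= 1) /\
  forall e, 0 < e -> \forall v \near (1%g : G), forall x, `|f (v * x)%g - f x| <= e.

Lemma ruc01_translate f g : ruc01 f -> ruc01 (fun x => f (g * x)%g).
Proof.
move=> [f01 fu]; split=> // e e0.
apply: filterS (nbhs1_conj g (fu e e0)) => v fv x.
by rewrite -[(g * (v * x))%g](_ : (g * v * g^-1 * (g * x)) = _)%g ?fv// !mulgA mulgVK.
Qed.

Hypothesis lcG : locally_compact [set: G].
Hypothesis hG : hausdorff_space G.

(** A continuous function which is constant outside a compact set is uniformly
    continuous. *)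
Lemma ruc01_bump U : nbhs (1%g : G) U ->
  exists f, [/\ ruc01 f, f 1%g = 0 & forall x, ~ U x -> f x = 1].
Proof.
move=> U1; have [K [K1 cK Ksym]] := symmetric_compact_nbhs1 lcG.
pose V := (U `&` K)°.
have V1 : V 1%g by apply: nbhs_singleton; apply: nbhs_interior; exact: filterI.
have clV : closed (~` V) by apply: open_closedC; exact: open_interior.
have := locally_compact_completely_regular (R := R) lcG hG clV.
move=> /(_ 1%g (fun k => k V1)) /uniform_separatorP => /(_ R)[f [cf f01 f0 f1]].
have {}f1 x : ~ V x -> f x = 1 by move=> Vx; apply: f1; exists x.
exists f; split; last 2 first.
- by apply: f0; exists 1%g.
- by move=> x Ux; apply: f1 => /interior_subset [].
split=> [x|e e0].
  by have /= := f01 (f x) (ex_intro2 _ _ x I erefl); rewrite in_itv.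
(* Outside of K * K, both terms of the difference are 1. *)
have /compact_near_coveringP nearK := compact_mulg cK cK.
have near_eq : \forall v \near (1%g : G),
    [set x * y | x in K & y in K]%g `<=` [set x | `|f (v * x)%g - f x| <= e].
  apply: nearK => x _.
  have c : continuous (fun p : G * G => f (p.2 * p.1)%g - f p.1).
    move=> p; apply: cvgB; last by apply: continuous_comp; [exact: cvg_fst|exact: cf].
    apply: continuous_comp; last exact: cf.
    by apply: continuous_mulg => q; [exact: cvg_snd|exact: cvg_fst].
  have /cvgrPdist_le /(_ e e0) := c (x, 1%g).
  rewrite /= mul1g subrr.
  by apply: filterS => -[y v] /=; rewrite sub0r normrN.
near=> v => x.
have [Kx|nKx] := pselect ([set x * y | x in K & y in K]%g x).
  by move: x Kx; near: v.
rewrite f1 ?f1 ?subrr ?normr0 ?ltW//.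
  move=> /interior_subset [_ Kx]; apply: nKx; exists 1%g; first exact: nbhs_singleton.
  by exists x => //; rewrite mul1g.
move=> /interior_subset [_ Kvx]; apply: nKx; exists v^-1%g.
  by apply: Ksym; near: v.
by exists (v * x)%g => //; rewrite mulKg.
Unshelve. all: end_near. Qed.

(** The witness is the infimum over [b] in [B] of the right translates
    [x |-> k (x * b^-1)] of one bump function [k]. Right translation preserves the
    uniform estimate of [k] verbatim, so the infimum of the family satisfies it too,
    however large [B] is. *)
Lemma ruc01_separation U B : nbhs (1%g : G) U ->
  exists f, [/\ ruc01 f, forall b, B b -> f b = 0
    & forall x, (forall b, B b -> ~ U (x * b^-1)%g) -> f x = 1].
Proof.
move=> U1; have [k [[k01 ku] k0 k1]] := ruc01_bump U1.
pose S x := [set k (x * b^-1)%g | b in B] `|` [set 1].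
have Slb x : lbound (S x) 0.
  by move=> _ [[b _ <-]|->]; [have /andP[] := k01 (x * b^-1)%g|].
have Sinf x : has_inf (S x) by split; [exists 1; right|exists 0; exact: Slb].
have leS x b : B b -> inf (S x) <= k (x * b^-1)%g.
  by move=> Bb; apply: ge_inf; [have [] := Sinf x|left; exists b].
have le1 x : inf (S x) <= 1 by apply: ge_inf; [have [] := Sinf x|right].
exists (fun x => inf (S x)); split.
- split=> [x|e e0].
    by rewrite le1 andbT lb_le_inf//; have [] := Sinf x.
  apply: filterS (ku e e0) => v kv x; rewrite ler_distl; apply/andP; split.
    apply: lb_le_inf; first by have [] := Sinf (v * x)%g.
    move=> _ [[b Bb <-]|->]; last by rewrite lerBlDr (le_trans (le1 _))// lerDl ltW.
    rewrite lerBlDr (le_trans (leS x b Bb))//.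
    by have := kv (x * b^-1)%g; rewrite mulgA distrC ler_distl => /andP[_ ->].
  rewrite -lerBlDr; apply: lb_le_inf; first by have [] := Sinf x.
  move=> _ [[b Bb <-]|->]; last by rewrite lerBlDr (le_trans (le1 _))// lerDl ltW.
  rewrite lerBlDr (le_trans (leS _ b Bb))//.
  by have := kv (x * b^-1)%g; rewrite mulgA ler_distl => /andP[_ ->].
- move=> b Bb; apply/eqP; rewrite eq_le; apply/andP; split.
    by rewrite (le_trans (leS _ _ Bb))// mulgV k0.
  by apply: lb_le_inf => //; have [] := Sinf b.
- move=> x xB; suff -> : S x = [set 1] by rewrite inf1.
  by apply/seteqP; split=> [_ [[b Bb <-]|->]//|_ ->]; [exact/k1/xB|right].
Qed.

End uniformly_continuous_functions.

(** * Displacement of ultrafilters by a group element *)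

Lemma ultra_bigcup T (p : set_system T) (P : nat -> set T) n :
  UltraFilter p -> (forall x, exists2 i, (i < n)%N & P i x) -> exists i, p (P i).
Proof.
move=> pU cov; apply: contrapT => /forallNP nP.
have : p [set x | forall i, (i < n)%N -> ~ P i x].
  elim: n {cov} => [|n IH]; first by apply: filterS filterT.
  have [/nP//|pn] := in_ultra_setVsetC (P n) pU.
  apply: filterS (filterI IH pn) => x [xn nPx] i.
  by rewrite ltnS leq_eqVlt => /orP[/eqP ->|/xn].
by move=> /filter_ex[x nx]; have [i /nx] := cov x.
Qed.

Definition independent T (E : T -> T -> Prop) (A : set T) :=
  forall x y, A x -> A y -> x <> y -> ~ E x y.

Lemma maximal_independent T (E : T -> T -> Prop) (B : set T) :
  exists A, [/\ A `<=` B, independent E A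
    & forall x, B x -> A x \/ exists2 y, A y & E x y \/ E y x].
Proof.
have [F FP totF|A [[AB indA] maxA]] :=
    @Zorn_bigcup T [set A | A `<=` B /\ independent E A].
  split=> [x [X /FP [XB _]] /XB//|x y [X FX Xx] [Y FY Yy]].
  by have [XY|YX] := totF _ _ FX FY;
    [have [_] := FP _ FY|have [_] := FP _ FX]; apply=> //; [exact: XY|exact: YX].
exists A; split=> // x Bx; apply: contrapT => /not_orP[nAx nEx].
apply: (maxA (x |` A)).
  by split=> [y|/(_ x (or_introl erefl))//]; right.
split=> [y [->//|/AB//]|y z [->|Ay] [->|Az] yz //].
- by move=> Exz; apply: nEx; exists z => //; left.
- by move=> Eyx; apply: nEx; exists y => //; right.
- exact: indA.
Qed.

(** Colour classes are peeled off greedily, each one a maximal independent set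
    in what is left: a vertex surviving [n] rounds has a neighbour in each of the
    [n] classes removed. *)
Lemma greedy_coloring T (E : T -> T -> Prop) (A : set T) :
  exists C : nat -> set T,
  [/\ forall n, C n `<=` A, forall n, independent E (C n),
      forall m n x, C m x -> C n x -> m = n
    & forall n x, A x -> (exists2 i, (i < n)%N & C i x) \/
        forall i, (i < n)%N -> exists2 y, C i y & E x y \/ E y x].
Proof.
have [mis misP] := choice (fun B => maximal_independent E B).
pose rest := fix rest n := if n is m.+1 then rest m `\` mis (rest m) else A.
have restS m n : (m <= n)%N -> rest n `<=` rest m.
  by elim: n => [|n IH]; rewrite leq_eqVlt => /orP[/eqP ->//|]// /IH mn x [/mn].
pose C n := mis (rest n).
have Crest n : C n `<=` rest n by have [] := misP (rest n).
have Cdisj m n x : (m < n)%N -> C m x -> ~ C n x.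
  by move=> mn Cm /Crest /(restS _ _ mn) [].
exists C; split.
- by move=> n x /Crest /(restS 0%N n (leq0n n)).
- by move=> n; have [] := misP (rest n).
- move=> m n x Cm Cn.
  by case: (ltngtP m n) => // /Cdisj; [move/(_ _ Cm)|move/(_ _ Cn)].
- move=> n x Ax.
  have [rx|nrx] := pselect (rest n x); [right|left].
    move=> i ltin; have [_ _ /(_ x)] := misP (rest i).
    by have [ri nC] := restS _ _ ltin x rx => /(_ ri)[].
  elim: n nrx => [//|n IH] nr; have [rn|/IH[i ltin]] := pselect (rest n x).
    by exists n => //; apply: contrapT => nC; apply: nr.
  by exists i => //; exact: leqW.
Qed.

Section displacement.
Context {G : topologicalGroupType}.
Implicit Types (g h x y : G) (K Q P : set G).

(** A compact set is covered by finitely many translates of a small neighborhood,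
    and each translate contains at most one point of a separated set. *)
Lemma compact_separated_bound K Q : compact K -> nbhs 1%g Q ->
  exists N, forall n (s : nat -> G), (forall i, (i < n)%N -> K (s i)) ->
    (forall i j, (i < n)%N -> (j < n)%N -> i <> j -> ~ Q (s i * (s j)^-1)%g) ->
    (n <= N)%N.
Proof.
move=> cK Q1; have [V V1 VQ] := nbhs1_div Q1.
have : exists c : seq G, forall x, K x -> exists2 z, z \in c & V (x * z^-1)%g.
  apply: (compact_ind (P := fun A => exists c : seq G,
    forall x, A x -> exists2 z, z \in c & V (x * z^-1)%g)) cK.
  - by exists [::].
  - move=> A B [c cA] [d dB]; exists (c ++ d) => x.
    by move=> [/cA|/dB][z zc Vz]; exists z => //; rewrite mem_cat zc ?orbT.
  - by move=> A B AB [c cB]; exists c => x /AB/cB.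
  - move=> x _; exists [set y | V (y * x^-1)%g]; first exact: nbhs1_mulr.
    by exists [:: x] => y Vy; exists x => //; rewrite inE.
move=> [c cK']; exists (size c) => n s sK sep.
have [r rP] : exists r : nat -> G, forall i, (i < n)%N ->
    r i \in c /\ V (s i * (r i)^-1)%g.
  have /choice[r rP] i : exists z, (i < n)%N -> z \in c /\ V (s i * z^-1)%g.
    have [ltin|] := boolP (i < n)%N; last by exists 1%g.
    by have [z] := cK' _ (sK i ltin); exists z.
  by exists r.
have : {subset map r (iota 0 n) <= c}.
  by move=> z /mapP[i]; rewrite mem_iota => /andP[_ /rP[rc _]] ->.
move=> /uniq_leq_size; rewrite size_map size_iota; apply.
rewrite map_inj_in_uniq ?iota_uniq// => i j.
rewrite !mem_iota !add0n => /andP[_ lin] /andP[_ ljn] rij.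
apply: contrapT => ij; apply: (sep i j) => //.
have [_ Vi] := rP i lin; have [_ Vj] := rP j ljn.
by have := VQ _ _ Vi Vj; rewrite rij mulgKA.
Qed.

Section far_set.
Variable Q : set G.
Hypotheses (Q1 : nbhs 1%g Q) (cQ : compact Q).
Hypothesis Qsym : forall x, Q x -> Q x^-1%g.

(** The far-moving elements act freely on ultrafilters, with room to spare.
    The cells [Q * a], for [a] in a maximal [Q]-separated set [A], cover the group;
    join [a] and [b] when [h] brings the cell of [a] within [Q] of the cell of [b].
    This graph has bounded degree because [A] is uniformly discrete, and no loops
    because [h] is outside [Q * Q * Q]. So finitely many colours suffice, and the
    ultrafilter contains the union of the cells of one colour. *)
Lemma ultra_displacement h (p : set_system G) : UltraFilter p ->
    ~ [set x * y | x in [set x * y | x in Q & y in Q] & y in Q]%g h ->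
  exists2 P, p P & forall x y q, P x -> P y -> Q q -> y <> (q * h * x)%g.
Proof.
move=> pU hfar.
have [A [_ indA maxA]] := maximal_independent (fun x y => Q (x * y^-1)%g) setT.
(* [b * a^-1] lies in [D] exactly when [Q * h * Q * a] meets [Q * b]. *)
pose D := [set v * z | v in [set v * q | v in Q & q in Q]
                     & z in [set h * u | u in Q]]%g.
have cD : compact (D `|` [set d^-1 | d in D])%g.
  have ? : compact D.
    apply: compact_mulg; first exact: compact_mulg.
    apply: continuous_compact => //; apply: continuous_subspaceT.
    by apply: continuous_mulg => t; [exact: cvg_cst|exact: cvg_id].
  apply: compactU => //; apply: continuous_compact => //.
  exact/continuous_subspaceT/invg_continuous.
have [N Nbound] := compact_separated_bound cD Q1.
pose E a b := D (b * a^-1)%g.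
have [C [CA indC Cdisj Ccov]] := greedy_coloring E A.
have few x : A x -> exists2 i, (i < N.+1)%N & C i x.
  move=> Ax; have [//|nbr] := Ccov N.+1 x Ax; exfalso.
  have /choice[y yP] i : exists y, (i < N.+1)%N -> C i y /\ (E x y \/ E y x).
    have [/nbr[y Cy Exy]|] := boolP (i < N.+1)%N; first by exists y.
    by exists 1%g.
  suff : (N.+1 <= N)%N by rewrite ltnn.
  apply: (Nbound _ (fun i => y i * x^-1)%g)
    => [i /yP[_ [Exy|Eyx]]|i j /yP[Ci _] /yP[Cj _] ij].
  - by left.
  - by right; exists (x * (y i)^-1)%g => //; rewrite invgF.
  - rewrite mulgKA; apply: indA; [exact: CA Ci|exact: CA Cj|].
    by move=> yij; apply: ij; apply: (Cdisj _ _ (y i)) => //; rewrite yij.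
have [x|i pP] := @ultra_bigcup _ p
    (fun i => [set (q * a)%g | q in Q & a in C i]) N.+1 pU.
  have [Ax|[a Aa Qxa]] := maxA x Logic.I.
    have [i iN Ci] := few x Ax; exists i => //.
    by exists 1%g; [exact: nbhs_singleton|exists x => //; rewrite mul1g].
  have [i iN Ci] := few a Aa; exists i => //.
  exists (x * a^-1)%g; last by exists a => //; rewrite mulgVK.
  by case: Qxa => // /Qsym; rewrite invgF.
exists [set (q * a)%g | q in Q & a in C i] => //.
move=> _ _ q [u Qu [a Ca <-]] [v Qv [b Cb <-]] Qq bE.
have {}bE : b = (v^-1 * q * (h * u) * a)%g.
  by rewrite -[LHS](mulKg v) bE !mulgA.
have [ab|ab] := pselect (a = b); last first.
  apply: (indC i a b Ca Cb ab); rewrite /E bE mulgK.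
  exists (v^-1 * q)%g; first by exists v^-1%g; [exact: Qsym|exists q].
  by exists (h * u)%g => //; exists u.
apply: hfar; exists (q^-1 * v)%g.
  by exists q^-1%g; [exact: Qsym|exists v].
exists u^-1%g; first exact: Qsym.
have : (v^-1 * q * (h * u) = 1)%g by apply: (mulIg a); rewrite -bE mul1g.
by rewrite mulgA => /mulg1_eq <-; rewrite invgK -!mulgA mulVKg mulKg.
Qed.

End far_set.
End displacement.

(** * Absence of recurrence along sequences *)

Section no_return.
Context {R : realType} {G : topologicalGroupType}.
Local Open Scope ring_scope.

Hypothesis lcG : locally_compact [set: G].
Hypothesis hG : hausdorff_space G.

Lemma cvg_eq_on T (p : set_system T) (A : set T) (f : T -> R) (l c : R)
    {pP : ProperFilter p} :
  f @ p --> l -> p A -> (forall x, A x -> f x = c) -> l = c.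
Proof.
move=> fl pA fA; apply: (@cvg_unique _ (@Rhausdorff R) (f @ p)) => //.
by apply: cvg_near_cst; apply: filterS pA => x /fA ->.
Qed.

(** Think of [z] as the point of the greatest ambit represented by [p]. If [g n]
    returned [z] to itself, then along a sparse subsequence each [g (s i)] would map
    a large set [W i] close to all earlier sets [P (s j)], hence away from the images
    [g (s j) * W j]. The union of the images of even rank is then uniformly separated
    from the images of odd rank, and a function that separates them takes the values
    0 and 1 alternately along the subsequence. *)
Lemma no_return_far (U : set G) (p : set_system G) (z : (G -> R) -> R)
    (g : nat -> G) (P : nat -> set G) :
  nbhs 1%g U -> (forall x, U x -> U x^-1%g) -> UltraFilter p ->
  (forall f, ruc01 f -> f @ p --> z f) ->
  (forall n, p (P n)) ->
  (forall n x y u v, P n x -> P n y -> U u -> U v -> y <> (u * v * g n * x)%g) ->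
  ~ (forall f, ruc01 f -> (fun n => z (fun x => f (g n * x)%g)) @ \oo --> z f).
Proof.
move=> U1 Usym pU zP pP far gz.
pose UP n := [set u * w | u in U & w in P n]%g.
have /choice[m0 m0P] n : exists m0, forall m, (m0 <= m)%N ->
    p [set x | UP n (g m * x)%g].
  have [f [fr f0 f1]] := ruc01_separation (R := R) lcG hG (P n) U1.
  have zf : z f = 0 by apply: (cvg_eq_on (zP _ fr) (pP n) f0).
  have /cvgrPdist_lt/(_ 1 ltr01)[m0 _ m0P] := gz f fr.
  exists m0 => m /m0P /=; rewrite zf sub0r normrN => zlt.
  have := zP _ (ruc01_translate (g m) fr).
  move=> /cvgr_lt/(_ 1 (le_lt_trans (ler_norm _) zlt)).
  apply: filterS => x /= fx1; apply: contrapT => nUP.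
  move: fx1; rewrite f1 ?ltxx// => b Pb Ub; apply: nUP.
  by exists (g m * x * b^-1)%g => //; exists b => //; rewrite mulgVK.
(* The sum only serves to dominate [m0 k] for every [k] up to [s j]. *)
pose s := fix s i := if i is j.+1 then (s j + \sum_(k < (s j).+1) m0 k).+1%N else 0%N.
have sm0 i j : (j < i)%N -> (m0 (s j) <= s i)%N.
  elim: i => [//|i IH]; rewrite ltnS leq_eqVlt => /orP[/eqP ->|/IH ji] /=.
    by rewrite big_ord_recr /= addnA -addSn leq_addl.
  by rewrite (leq_trans ji)// -addSn leqW// leq_addr.
have si i : (i <= s i)%N.
  by elim: i => [//|i IH] /=; rewrite ltnS (leq_trans IH)// leq_addr.
pose W i := [set x | P (s i) x /\ forall j, (j < i)%N -> UP (s j) (g (s i) * x)%g].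
have pW i : p (W i).
  rewrite /W; apply: (filterI (pP (s i))).
  suff H n : (n <= i)%N -> p [set x | forall j, (j < n)%N -> UP (s j) (g (s i) * x)%g].
    exact: H.
  elim: n => [|n IH] ni; first by apply: filterS filterT.
  apply: filterS (filterI (IH (ltnW ni)) (m0P _ _ (sm0 _ _ ni))) => x [Hx Ux] j.
  by rewrite ltnS leq_eqVlt => /orP[/eqP ->|/Hx].
pose B := \bigcup_(i in [set i | ~~ odd i]) [set g (s i) * x | x in W i]%g.
have [f [fr f0 f1]] := ruc01_separation (R := R) lcG hG B U1.
have even0 i : ~~ odd i -> z (fun x => f (g (s i) * x)%g) = 0.
  move=> ei; apply: (cvg_eq_on (zP _ (ruc01_translate (g (s i)) fr)) (pW i)).
  by move=> x Wx; apply: f0; exists i => //; exists x.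
have odd1 i : odd i -> z (fun x => f (g (s i) * x)%g) = 1.
  move=> oi; apply: (cvg_eq_on (zP _ (ruc01_translate (g (s i)) fr)) (pW i)).
  move=> x [Px xU]; apply: f1 => _ [j ej [y [Py yU] <-]] Uxy.
  have : j <> i by move=> ji; move: ej; rewrite /= ji oi.
  set u := (_ * _^-1)%g in Uxy.
  have xE : (g (s i) * x = u * (g (s j) * y))%g by rewrite /u mulgVK.
  clearbody u.
  case: (ltngtP j i) => // ji _.
    have [v Uv [w Pw vwE]] := xU j ji.
    apply: (far (s j) y w v^-1%g u) => //; first exact: Usym.
    by rewrite -!mulgA -xE -vwE mulKg.
  have [v Uv [w Pw vwE]] := yU i ji.
  apply: (far (s i) x w v^-1%g u^-1%g) => //; [exact: Usym|exact: Usym|].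
  by rewrite -!mulgA xE mulKg -vwE mulKg.
have /cvgrPdist_lt/(_ (2^-1))[|n0 _ n0P] := gz f fr; first by rewrite invr_gt0.
have big i : (n0 <= i)%N -> `|z f - z (fun x => f (g (s i) * x)%g)| < 2^-1.
  by move=> ?; apply: n0P; rewrite /= (leq_trans _ (si i)).
have n2 : (n0 <= n0.*2)%N by rewrite -addnn leq_addr.
have lt0 : `|z f - 0| < 2^-1.
  by have := big _ n2; rewrite even0 // odd_double.
have lt1 : `|z f - 1| < 2^-1.
  by have := big _ (leqW n2); rewrite odd1 //= odd_double.
have := ltrD lt0 lt1; rewrite -[2^-1]mul1r -splitr ltNge => /negP; apply.
rewrite (le_trans _ (ler_normB _ _))// (_ : _ - _ = 1) ?normr1//.
by rewrite subr0 opprB addrC subrK.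
Qed.

(** [L] has to be large compared with the neighborhood [U] used to separate sets: the
    product of two elements of [U] enters when two near-membership relations are
    combined, which is why the displacement is taken relative to [Q = U * U]. *)
Lemma no_return : exists2 L : set G, compact L &
  forall (p : set_system G) (z : (G -> R) -> R) (g : nat -> G),
    UltraFilter p -> (forall f, ruc01 f -> f @ p --> z f) ->
    (forall n, ~ L (g n)) ->
    ~ (forall f, ruc01 f -> (fun n => z (fun x => f (g n * x)%g)) @ \oo --> z f).
Proof.
have [U [U1 cU Usym]] := symmetric_compact_nbhs1 lcG.
pose Q := [set u * v | u in U & v in U]%g.
have cQ : compact Q by exact: compact_mulg.
have Q1 : nbhs 1%g Q.
  apply: (filterS _ U1) => u Uu; exists 1%g; first exact: nbhs_singleton.
  by exists u => //; exact: mul1g.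
have Qsym x : Q x -> Q x^-1%g.
  move=> [u Uu [v Uv <-]]; exists v^-1%g; first exact: Usym.
  by exists u^-1%g; [exact: Usym|rewrite invgM].
exists [set x * y | x in [set x * y | x in Q & y in Q] & y in Q]%g.
  exact: compact_mulg (compact_mulg cQ cQ) cQ.
move=> p z g pU zP gL.
have /choice[P PP] n : exists P, p P /\
    forall x y q, P x -> P y -> Q q -> y <> (q * g n * x)%g.
  by have [P ? ?] := ultra_displacement Q1 cQ Qsym pU (gL n); exists P.
apply: (no_return_far U1 Usym pU zP (P := P)) => [n|n x y u v Px Py Uu Uv].
  by have [] := PP n.
by have [_] := PP n; apply => //; exists u => //; exists v.
Qed.

End no_return.

(** * Subflows and minimal flows *)

Section set_type_topology.
Context {T : topologicalType} {A : set T}.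

Lemma set_val_continuous : continuous (set_val : A -> T).
Proof. exact: initial_continuous. Qed.

Lemma set_type_compact : compact A -> compact [set: A].
Proof.
move=> cA F FF _.
have FA : F (set_val @^-1` A).
  by apply: filterS (@filterT _ F _) => a _; exact: set_valP.
have [x [Ax clx]] := cA (set_val @ F) _ FA.
exists (SigSub (mem_set Ax)); split=> // B U FB [_ [[W oW <-] Wx WU]].
have FvB : F (set_val @^-1` (set_val @` B)) by apply: filterS FB => b Bb; exists b.
have [y [[b Bb <-] Wb]] := clx (set_val @` B) W FvB (open_nbhs_nbhs (conj oW Wx)).
by exists b; split => //; exact: WU.
Qed.

Lemma set_type_hausdorff : hausdorff_space T -> hausdorff_space A.
Proof.
move=> hT x y clxy; apply: val_inj; apply: hT => U V /= Ux Vy.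
have [z [Uz Vz]] := clxy _ _ (@set_val_continuous x _ Ux) (@set_val_continuous y _ Vy).
by exists (set_val z).
Qed.

End set_type_topology.

Section subflow.
Context {G : topologicalGroupType} (Y : flow G) (A : set Y).
Hypothesis clA : closed A.
Hypothesis invA : forall g y, A y -> A (flow_act g y).

Definition subflow_act (g : G) (a : A) : A :=
  SigSub (mem_set (invA g (set_valP a))).

Lemma subflow_act1 a : subflow_act 1%g a = a.
Proof. by apply: val_inj; exact: flow_act1. Qed.

Lemma subflow_actM g h a :
  subflow_act (g * h)%g a = subflow_act g (subflow_act h a).
Proof. by apply: val_inj; exact: flow_actM. Qed.

Lemma subflow_act_continuous :
  continuous (fun p : G * A => subflow_act p.1 p.2).
Proof.
apply: continuous_comp_initial => -[g a].
apply: (@continuous_comp _ _ _ (fun p : G * A => (p.1, set_val p.2))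
  (fun p : G * Y => flow_act p.1 p.2)); last exact: flow_act_continuous.
apply: cvg_pair; first exact: cvg_fst.
by apply: continuous_comp; [exact: cvg_snd|exact: set_val_continuous].
Qed.

Definition subflow : flow G :=
  Flow (set_type_compact (subclosed_compact clA (@flow_compact _ Y) (@subsetT _ A)))
    (set_type_hausdorff (@flow_hausdorff _ Y))
    subflow_act1 subflow_actM subflow_act_continuous.

End subflow.

Section minimal_subflow.
Context {G : topologicalGroupType}.

Lemma flow_act_continuous_r (Y : flow G) (g : G) : continuous (@flow_act G Y g).
Proof.
move=> y; apply: (@continuous_comp _ _ _ (fun y => (g, y))
  (fun p : G * Y => flow_act p.1 p.2)); last exact: flow_act_continuous.
by apply: cvg_pair; [exact: cvg_cst|exact: cvg_id].
Qed.

Lemma flow_actK (Y : flow G) (g : G) : cancel (@flow_act G Y g) (flow_act g^-1%g).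
Proof. by move=> y; rewrite -flow_actM mulVg flow_act1. Qed.

(** Zorn's lemma is applied to the proper open invariant sets; chains have upper
    bounds by compactness. The complement of a maximal such set is a minimal subflow,
    since the translates of an open set missed by some orbit could be added to it. *)
Lemma exists_minimal_flow (Y : flow G) : [set: Y] !=set0 ->
  exists (X : flow G) (f : X -> Y),
    [/\ minimal_flow X, continuous f & equivariant f].
Proof.
move=> [y0 _].
have [F FP totF|B [[oB invB [x0 nBx0]] maxB]] := @Zorn_bigcup Y
    [set B | [/\ open B, forall g y, B y -> B (flow_act g y) & exists y, ~ B y]].
  split=> [|g y [B FB By]|].
  - by apply: bigcup_open => B /FP[].
  - by exists B => //; have [_ + _] := FP B FB; apply.
  - apply: contrapT => /forallNP cov.
    have : [set: Y] = set0 \/ exists2 B, F B & [set: Y] `<=` B.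
      apply: (compact_ind (P := fun K => K = set0 \/ exists2 B, F B & K `<=` B))
          (@flow_compact _ Y).
      + by left.
      + move=> K L [->|[B FB KB]]; first by rewrite set0U.
        move=> [->|[C FC LC]]; first by rewrite setU0; right; exists B.
        right; have [BC|CB] := totF _ _ FB FC.
          by exists C => // x [/KB/BC|/LC].
        by exists B => // x [/KB|/LC/CB].
      + move=> K L KL [L0|[B FB LB]]; last by right; exists B => // x /KL/LB.
        by left; rewrite -subset0 -L0.
      + move=> y _; have [B FB By] := contrapT (cov y).
        exists B; last by right; exists B.
        by have [oB _ _] := FP B FB; exact: open_nbhs_nbhs.
    move=> [YE|[B FB YB]]; first by have : [set: Y] y0 by []; rewrite YE.
    by have [_ _ [y]] := FP B FB; apply; exact: YB.
have invC g y : (~` B) y -> (~` B) (flow_act g y).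
  by move=> nBy /(invB g^-1%g); rewrite flow_actK.
exists (subflow (open_closedC oB) invC), set_val; split.
- split=> [|x O [w Ow] oO]; first by exists (SigSub (mem_set (nBx0 : (~` B) x0))).
  apply: contrapT => nO.
  have [W oW WO] : exists2 W : set Y, open W & set_val @^-1` W = O.
    by case: oO => W oW WO; exists W.
  apply: (maxB (B `|` \bigcup_g (flow_act g @^-1` W))).
    split=> [z Bz|]; first by left.
    move=> /(_ (set_val w)) sub.
    have := set_valP w; apply; apply: sub; right.
    by exists 1%g => //; rewrite /preimage/= flow_act1; rewrite -WO in Ow.
  split.
  + apply: openU => //; apply: bigcup_open => g _.
    by apply: open_comp => // ? _; exact: flow_act_continuous_r.
  + move=> g y [By|[h _ Wy]]; first by left; exact: invB.
    by right; exists (h * g^-1)%g => //; rewrite /preimage/= flow_actM flow_actK.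
  + exists (set_val x) => -[|[g _ Wgx]]; first by have := set_valP x.
    apply: nO; exists (flow_act g x); split; last by exists g.
    by rewrite -WO.
- exact: set_val_continuous.
- by [].
Qed.

End minimal_subflow.

(** * The greatest ambit *)

Section greatest_ambit.
Context (R : realType) (G : topologicalGroupType).

Local Open Scope ring_scope.

(* Tychonoff's theorem asks for an index type with decidable equality. *)
Let I : choiceType := {classic {f : G -> R | ruc01 f}}.
Let X : topologicalType := {ptws I -> R}.

Let shift (g : G) (i : I) : I :=
  exist _ (fun x => sval i (g * x)%g) (ruc01_translate g (svalP i)).

Let sval_injI (i j : I) : sval i = sval j -> i = j.
Proof.
by case: i j => [f fr] [k kr] /= fk; apply: eq_exist.
Qed.

Let ev (x : G) : X := fun i => sval i x.

Let ambit_set : set X := closure (range ev).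

Let proj_cont (i : I) : continuous (fun z : X => z i).
Proof. exact: (@proj_continuous I (fun=> R) i). Qed.

Let compact_ambit_set : compact ambit_set.
Proof.
apply: (subclosed_compact (B := [set z : X | forall i : I, [set` `[0, 1]] (z i : R)])).
- exact: closed_closure.
- by apply: (@tychonoff I (fun=> R) (fun=> [set` `[0, 1]])) => _; exact: segment_compact.
- move=> z zc i.
  have cl01 : closed [set` (`[0, 1] : interval R)] by exact: interval_closed.
  apply: cl01 => V Vz; have [_ [[x _ <-] Vx]] := zc _ (@proj_cont i z _ Vz).
  exists (ev x i); split => //.
  by have [f01 _] := svalP i; rewrite /= in_itv/=; exact: f01.
Qed.

Let act (g : G) (z : X) : X := fun i => z (shift g i).

Let continuous_into (T : topologicalType) (f : T -> X) :
  (forall i, continuous (fun t => f t i)) -> continuous f.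
Proof.
move=> cf t; apply/cvg_sup => i; apply: continuous_comp_initial => u.
exact: cf.
Qed.

Let act_ambit g (z : X) : ambit_set z -> ambit_set (act g z).
Proof.
have cact : continuous (act g) by apply: continuous_into => i; exact: proj_cont.
move=> zc V Vz; have [_ [[x _ <-] Vx]] := zc _ (@cact z _ Vz).
exists (act g (ev x)); split => //.
Qed.

Let ambit : topologicalType := set_type ambit_set.

Let coord_cont (i : I) : continuous (fun z : ambit => \val z i).
Proof.
move=> z; apply: (@continuous_comp _ _ _ set_val (fun w : X => w i)).
  exact: set_val_continuous.
exact: proj_cont.
Qed.

Let ambit_act (g : G) (z : ambit) : ambit :=
  SigSub (mem_set (act_ambit (g := g) (set_valP z))).

Let ambit_act1 (z : ambit) : ambit_act 1%g z = z.
Proof.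
apply: val_inj => /=; apply/funext => i; congr (\val z _); apply: sval_injI.
by apply/funext => x /=; rewrite mul1g.
Qed.

Let ambit_actM g h (z : ambit) :
  ambit_act (g * h)%g z = ambit_act g (ambit_act h z).
Proof.
apply: val_inj => /=; apply/funext => i; congr (\val z _); apply: sval_injI.
by apply/funext => x /=; rewrite mulgA.
Qed.

(* Joint continuity of the action rests on this uniform bound, which holds for
   evaluations and passes to their limits. *)
Let ambit_lipschitz (z : X) (i j : I) e : ambit_set z ->
  (forall x, `|sval i x - sval j x| <= e) -> `|z i - z j| <= e.
Proof.
move=> zc ij.
have c : continuous (fun z : X => `|z i - z j|).
  by move=> w; exact: (cvg_norm (cvgB (@proj_cont i w) (@proj_cont j w))).
have : closed [set z : X | `|z i - z j| <= e].
  by apply: (@closed_comp _ _ _ [set r | r <= e]) => [? _|]; [exact: c|exact: closed_le].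
apply=> V /zc [_ [[x _ <-] Vx]]; exists (ev x); split => //.
exact: ij.
Qed.

Let ambit_act_continuous :
  continuous (fun p : G * ambit => ambit_act p.1 p.2).
Proof.
apply: continuous_comp_initial; apply: continuous_into => i -[g0 z0] /=.
apply/cvgrPdist_le => e e0.
have e20 : 0 < e / 2 by rewrite divr_gt0.
have [_ /(_ _ e20) iu] := svalP i.
have near_g : \forall g \near g0, forall x,
    `|sval (shift g0 i) x - sval (shift g i) x| <= e / 2.
  apply: filterS (nbhs1_mulr g0 iu) => g ig x.
  by rewrite distrC /=; have := ig (g0 * x)%g; rewrite mulgA mulgVK.
have near_z : \forall z \near z0,
    `|\val z0 (shift g0 i) - \val z (shift g0 i)| <= e / 2.
  by have /cvgrPdist_le/(_ _ e20) := @coord_cont (shift g0 i) z0.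
exists ([set g | forall x, `|sval (shift g0 i) x - sval (shift g i) x| <= e / 2],
  [set z : ambit | `|\val z0 (shift g0 i) - \val z (shift g0 i)| <= e / 2]) => //.
move=> [g z] [/= ig iz]; rewrite [leRHS]splitr.
rewrite (le_trans (ler_distD (\val z (shift g0 i)) _ _))// lerD//.
exact: (ambit_lipschitz (i := shift g0 i) (j := shift g i) (set_valP z) ig).
Qed.

(** The closure of the evaluations in a cube is a concrete form of the maximal ideal
    space of the algebra of bounded right uniformly continuous functions. *)
Definition greatest_ambit : flow G :=
  @Flow G ambit ambit_act
    (set_type_compact compact_ambit_set)
    (set_type_hausdorff (@hausdorff_product I (fun=> R) (fun=> @Rhausdorff R)))
    ambit_act1 ambit_actM ambit_act_continuous.

Lemma greatest_ambit_nonempty : [set: greatest_ambit] !=set0.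
Proof.
have ev1 : ambit_set (ev 1%g) by apply: subset_closure; exists 1%g.
by exists (SigSub (mem_set ev1)).
Qed.

(** Through this lemma the ambit is handled by means of ultrafilters on the group:
    a point is the functional [l] of limits along some ultrafilter [p]. *)
Lemma greatest_ambit_point (z : greatest_ambit) :
  exists (p : set_system G) (l : (G -> R) -> R),
  [/\ UltraFilter p, forall f, ruc01 f -> f @ p --> l f
    & forall g : nat -> G, flow_act (g n) z @[n --> \oo] --> z ->
      forall f, ruc01 f -> (fun n => l (fun x => f (g n * x)%g)) @ \oo --> l f].
Proof.
have : closure (range ev) (\val z) := set_valP z.
rewrite closureEcvg => -[F FF [Fz Fev]].
pose q := filter_from F (fun W => ev @^-1` W).
have qF : ProperFilter q.
  apply: filter_from_proper.
    apply: filter_from_filter; first by exists setT; exact: filterT.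
    by move=> A B FA FB; exists (A `&` B) => //; exact: filterI.
  move=> A FA; have Fr : F (range ev) by apply: Fev.
  have [w [Aw [x _ xE]]] := filter_ex (filterI FA Fr).
  by exists x; rewrite /preimage/= xE.
have [p [pU qp]] := ultraFilterLemma qF.
pose l (f : G -> R) : R :=
  if pselect (ruc01 f) is left fr then \val z (exist _ f fr : I) else 0.
have lE f (fr : ruc01 f) : l f = \val z (exist _ f fr : I).
  by rewrite /l; case: pselect => // fr'; congr (\val z _); exact: sval_injI.
exists p, l; split => // [f fr|g gz f fr].
  rewrite (lE f fr) => V Vz; have := Fz _ (@proj_cont (exist _ f fr) _ V Vz) => FV.
  by apply: qp; exists [set z' : X | V (z' (exist _ f fr : I))].
have -> : (fun n => l (fun x => f (g n * x)%g)) =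
    (fun n => \val (flow_act (g n) z) (exist _ f fr : I)).
  apply/funext => n; rewrite (lE _ (ruc01_translate (g n) fr)).
  by rewrite /=; congr (\val z _); exact: sval_injI.
rewrite (lE f fr).
exact: (continuous_cvg _ (@coord_cont (exist _ f fr) z) gz).
Qed.

End greatest_ambit.

(** * Recurrence in minimal flows *)

Lemma countable_enumeration (T : choiceType) (A : set T) (x0 : T) : countable A ->
  exists e : nat -> T, (forall n, A (e n) \/ e n = x0) /\
    forall a, A a -> exists n, e n = a.
Proof.
move=> /countable_injP[k kinj].
exists (fun n => xget x0 [set a | A a /\ k a = n]); split=> [n|a Aa].
  by case: xgetP => [a _ [Aa _]|_]; [left|right].
exists (k a); case: xgetP => [b _ [Ab kb]|/(_ a)/(_ (conj Aa erefl))//].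
by apply: kinj; rewrite ?inE.
Qed.

(** Nested closures of open sets play the role of the shrinking balls of the metric
    version; regularity provides them. *)
Lemma compact_baire (X : topologicalType) (F : nat -> set X) :
    compact [set: X] -> hausdorff_space X -> [set: X] !=set0 ->
    (forall n, open (F n) /\ dense (F n)) ->
  \bigcap_n F n !=set0.
Proof.
move=> cX hX X0 odF.
have /choice[next nextP] (nW : (nat * set X)%type) :
  exists W', nW.2 !=set0 -> open nW.2 ->
    [/\ W' !=set0, open W' & closure W' `<=` nW.2 `&` F nW.1].
  have [[W0 oW]|nW0] := pselect (nW.2 !=set0 /\ open nW.2); last first.
    by exists set0 => W0 oW; exfalso; apply: nW0.
  have [oF dF] := odF nW.1; have [x WFx] := dF _ W0 oW.
  have nx : nbhs x (nW.2 `&` F nW.1) by apply: open_nbhs_nbhs; split => //; exact: openI.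
  have [N Nx clN] := compact_regular hX cX (filterT : nbhs x setT) nx.
  exists N° => _ _; split; first by exists x; exact: nbhs_singleton (nbhs_interior Nx).
    exact: open_interior.
  by apply: subset_trans clN; apply: closureS; exact: interior_subset.
pose W := fix W n := if n is m.+1 then next (m, W m) else setT.
have W0o n : W n !=set0 /\ open (W n).
  elim: n => [|n [W0 oW]] /=; first by split => //; exact: openT.
  by have [] := nextP (n, W n) W0 oW.
have clW n : closure (W n.+1) `<=` W n `&` F n.
  by have [W0 oW] := W0o n; have [] := nextP (n, W n) W0 oW.
have Wdec m n : (m <= n)%N -> W n `<=` W m.
  elim: n => [|n IH]; rewrite leq_eqVlt => /orP[/eqP ->//|]// /IH mn.
  by apply: subset_trans mn => x Wx; have [] := clW n x (subset_closure Wx).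
pose q := filter_from [set: nat] W.
have qF : ProperFilter q.
  apply: filter_from_proper; last by move=> n _; have [] := W0o n.
  apply: filter_from_filter; first by exists 0%N.
  move=> m n _ _; exists (maxn m n) => // x Wx.
  by split; apply: Wdec Wx; rewrite (leq_maxl, leq_maxr).
have [|x [_ clx]] := cX q qF; first exact: filterT.
exists x => n _; have [] // := clW n x.
by move=> V Vx; apply: clx => //; exists n.+1.
Qed.

Section minimal_flows.
Context {G : topologicalGroupType}.

Lemma flow_act_continuous_l (X : flow G) (x : X) : continuous (fun g : G => flow_act g x).
Proof.
move=> g; apply: (@continuous_comp _ _ _ (fun g => (g, x))
  (fun p : G * X => flow_act p.1 p.2)); last exact: flow_act_continuous.
by apply: cvg_pair; [exact: cvg_id|exact: cvg_cst].
Qed.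

Lemma compact_act (X : flow G) (x : X) (K : set G) :
  compact K -> compact [set flow_act g x | g in K].
Proof.
move=> cK; apply: continuous_compact => //; apply: continuous_subspaceT.
exact: flow_act_continuous_l.
Qed.

(** Translates of the interior of [K x] cover the space because every orbit meets it,
    and finitely many of them suffice. *)
Lemma minimal_flow_compact_cover (X : flow G) (x : X) (K : set G) :
    minimal_flow X -> compact K -> ([set flow_act g x | g in K])° !=set0 ->
  exists2 F : set G, compact F & forall y, exists2 f, F f & flow_act f x = y.
Proof.
move=> [_ mX] cK K0.
have [F cF XF] : exists2 F, compact F & [set: X] `<=` [set flow_act g x | g in F].
  apply: (compact_ind (P := fun A => exists2 F, compact F &
    A `<=` [set flow_act g x | g in F])) (@flow_compact _ X).
  - by exists set0 => //; exact: compact0.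
  - move=> A B [F cF AF] [E cE BE]; exists (F `|` E); first exact: compactU.
    by move=> y [/AF|/BE] [f Ff <-]; exists f => //; [left|right].
  - by move=> A B AB [F cF BF]; exists F => // y /AB/BF.
  - move=> y _; have [w [Ow [g _ gyE]]] := mX y _ K0 (@open_interior _ _).
    exists (flow_act g @^-1` ([set flow_act k x | k in K])°).
      apply: flow_act_continuous_r; rewrite gyE; apply: open_nbhs_nbhs.
      by split=> //; exact: open_interior.
    exists [set g^-1 * k | k in K]%g.
      apply: continuous_compact => //; apply: continuous_subspaceT.
      by apply: continuous_mulg => t; [exact: cvg_cst|exact: cvg_id].
    move=> v /interior_subset [k Kk kx]; exists (g^-1 * k)%g; first by exists k.
    by rewrite flow_actM kx flow_actK.
by exists F => // y; have [f Ff <-] := XF y Logic.I; exists f.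
Qed.

Hypothesis ncG : ~ compact [set: G].

(** The flow is here a quotient of [G] by a cocompact stabilizer, so a relatively
    compact stabilizer would make [G] compact. *)
Lemma stabilizer_not_in_compact (X : flow G) (x : X) (K L : set G) :
    minimal_flow X -> compact K -> ([set flow_act g x | g in K])° !=set0 ->
  compact L -> exists2 h, ~ L h & flow_act h x = x.
Proof.
move=> mX cK K0 cL; have [F cF FX] := minimal_flow_compact_cover mX cK K0.
apply: contrapT => stabL; apply: ncG.
have := compact_mulg cF cL; congr compact; apply/seteqP; split=> // g _.
have [f Ff fxE] := FX (flow_act g x); exists f => //.
exists (f^-1 * g)%g; last by rewrite mulVKg.
apply: contrapT => nL; apply: stabL; exists (f^-1 * g)%g => //.
by rewrite flow_actM -fxE flow_actK.
Qed.

(** If only elements of [L] brought [x] back to [V], then the closed set [L x] would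
    contain all orbit points in [V], hence the interior of [V] by density, and the
    stabilizer of [x] would be contained in [L], against
    [stabilizer_not_in_compact]. *)
Lemma minimal_flow_return (X : flow G) (x : X) (L : set G) (V : set X) :
    minimal_flow X -> compact L -> nbhs x V ->
  exists2 g, ~ L g & V (flow_act g x).
Proof.
move=> mX cL Vx; apply: contrapT => nret.
have retL g : V (flow_act g x) -> L g.
  by move=> Vg; apply: contrapT => nLg; apply: nret; exists g.
have VL : V° `<=` [set flow_act g x | g in L].
  have cLx : closed [set flow_act g x | g in L].
    by apply: compact_closed; [exact: flow_hausdorff|exact: compact_act].
  move=> y Vy; apply: cLx => W Wy; have [_ mX2] := mX.
  have [|w [[/interior_subset Vg Wg] [g _ gE]]] :=
      mX2 x (V° `&` W°) _ (openI (@open_interior _ _) (@open_interior _ _)).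
    by exists y; split => //; exact: nbhs_singleton (nbhs_interior Wy).
  exists (flow_act g x); split.
    by exists g => //; apply: retL; rewrite gE.
  by rewrite gE; exact: interior_subset Wg.
have L0 : ([set flow_act g x | g in L])° !=set0.
  by exists x; apply: (interiorS VL); exact: nbhs_interior.
have [h nLh hx] := stabilizer_not_in_compact mX cL L0 cL.
by apply: nLh; apply: retL; rewrite hx; exact: nbhs_singleton.
Qed.

End minimal_flows.

(** The orbit is a countable union of compact sets [K x], which cannot all be nowhere
    dense. *)
Lemma comeager_orbit_interior (G : topologicalGroupType) (X : flow G) (x : X) :
    separable_space G -> locally_compact [set: G] -> comeager (flow_orbit x) ->
  exists2 K : set G, compact K & ([set flow_act g x | g in K])° !=set0.
Proof.
move=> [D cD dD] lcG [S [O odO SE] Sx].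
have [U [U1 cU Usym]] := symmetric_compact_nbhs1 lcG.
have [d [_ dP]] := countable_enumeration 1%g cD.
pose K n := [set u * y | u in U & y in [set d n]]%g.
have cK n : compact (K n) by apply: compact_mulg => //; exact: compact_set1.
have GK g : exists n, K n g.
  have [||y [Uy Dy]] := dD ([set y | U (y * g^-1)%g])°.
  - by exists g; apply: nbhs_singleton; apply: nbhs_interior; exact: nbhs1_mulr.
  - exact: open_interior.
  have [n dn] := dP y Dy; exists n; exists (g * y^-1)%g.
    by have := Usym _ (interior_subset Uy); rewrite invgF.
  by exists y => //; rewrite mulgVK.
apply: contrapT => noint.
have [|n|y Ay] := @compact_baire X (fun n => O n `&` ~` [set flow_act g x | g in K n])
    (@flow_compact _ X) (@flow_hausdorff _ X).
- by exists x.
- have [oO dO] := odO n.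
  have oC : open (~` [set flow_act g x | g in K n]).
    apply: closed_openC; apply: compact_closed; first exact: flow_hausdorff.
    exact: compact_act.
  split; first exact: openI.
  move=> W W0 oW; have WO := dO W W0 oW.
  apply: contrapT => nW; apply: noint; exists (K n) => //.
  have [y WOy] := WO; exists y.
  have sub : W `&` O n `<=` [set flow_act g x | g in K n].
    by move=> w [Ww Ow]; apply: contrapT => nK; apply: nW; exists w.
  by apply: (interiorS sub); apply: open_nbhs_nbhs; split => //; exact: openI.
have : S y by rewrite SE => n _; have [] := Ay n Logic.I.
move=> /Sx[g _ gxy]; have [n Kg] := GK g.
by have [_] := Ay n Logic.I; apply; exists g.
Qed.

(** * Generic points and first countability *)

Lemma polish_hausdorff (R : realType) (T : topologicalType) :
  polish R T -> hausdorff_space T.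
Proof.
move=> [_ [M [f [g [cf _ fK _ _]]]]] x y clxy; apply: (can_inj fK).
apply: (@metric_hausdorff R M) => A B fxA fyB.
by have [z [Az Bz]] := clxy _ _ (cf x _ fxA) (cf y _ fyB); exists (f z).
Qed.

(** The greatest ambit has this property at each of its points, and it passes to any
    flow that maps continuously and equivariantly into the ambit. *)
Lemma exists_minimal_flow_no_return (R : realType) (G : topologicalGroupType) :
    locally_compact [set: G] -> hausdorff_space G ->
  exists (X : flow G) (L : set G), [/\ minimal_flow X, compact L
    & forall (x : X) (g : nat -> G), (forall n, ~ L (g n)) ->
        ~ (flow_act (g n) x @[n --> \oo] --> x)].
Proof.
move=> lcG hG; have [L cL noret] := no_return (R := R) lcG hG.
have [X [f [mX cf ef]]] := exists_minimal_flow (greatest_ambit_nonempty R G).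
exists X, L; split => // x g gL gx.
have [p [l [pU pl gl]]] := greatest_ambit_point (f x).
apply: (noret p l g pU pl gL); apply: gl.
rewrite (_ : (fun n => _) = f \o (fun n => flow_act (g n) x)).
  exact: (continuous_cvg _ (cf x) gx).
by apply/funext => n; rewrite /= ef.
Qed.

Theorem proposition7p13 (R : realType) (G : topologicalGroupType)
    (polishG : polish R G) (lcG : locally_compact [set: G]) :
  (GPP R G -> compact [set: G]) /\
  (~ compact [set: G] ->
     forall M : flow G, universal_minimal_flow M ->
     forall x : M, ~ first_countable_at x).
Proof.
have hG := polish_hausdorff polishG.
have [X [L [mX cL noret]]] := exists_minimal_flow_no_return R lcG hG.
split=> [[_ gpp]|ncG M [mM uM] x [B cB [Bx baseB]]].
  apply: contrapT => ncG; have [x cox] := gpp X mX.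
  have [K cK K0] := comeager_orbit_interior polishG.1 lcG cox.
  have [h nLh hx] := stabilizer_not_in_compact ncG mX cK K0 cL.
  by apply: (noret x (fun=> h)) => //; rewrite hx; exact: cvg_cst.
have [f [cf ef _]] := uM X mX.
have [V [VB eV]] := countable_enumeration setT cB.
have Vx n : nbhs x (V n).
  by have [/Bx//|->] := VB n; exact: filterT.
have VIx n : nbhs x [set y | forall k, (k <= n)%N -> V k y].
  elim: n => [|n IH].
    by apply: filterS (Vx 0%N) => y Vy k; rewrite leqn0 => /eqP ->.
  apply: filterS (filterI IH (Vx n.+1)) => y [IHy Vy] k.
  by rewrite leq_eqVlt => /orP[/eqP ->//|/IHy].
have /choice[g gP] n : exists g, ~ L g /\ forall k, (k <= n)%N -> V k (flow_act g x).
  by have [g] := minimal_flow_return ncG mM cL (VIx n); exists g.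
apply: (noret (f x) g) => [n|]; first by have [] := gP n.
rewrite (_ : (fun n => _) = f \o (fun n => flow_act (g n) x)); last first.
  by apply/funext => n; rewrite /= ef.
apply: (continuous_cvg _ (cf x)) => W /baseB[W' /eV[k <-] VW].
by exists k => // n kn; apply: VW; have [_] := gP n; exact.
Qed.
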